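(* Let $n,m,l$ be positive integers with $m<\frac{n}{2}$ and $l\geq n+1$, and let ${\bf A}_n^{(m,l)}$ be the analogous Craig lattice defined in the context. (1) If $n+1$ is a prime or $m=1$, then ${\bf A}_n^{(m,n+1)}$ equals the Craig lattice ${\bf A}_n^{(m)}$. (2) ${\bf A}_n^{(m,l)}$ is a lattice of rank $n$ with volume $l^{m-1}(n+1)^{1/2}$. Moreover, if $l$ is a prime number, then the minimum norm satisfies $\mu({\bf A}_n^{(m,l)})\geq 2m$.
   Context: Let $R={\bf Z}\langle 1,x,\dots,x^n\rangle$ be the free ${\bf Z}$-module of integer polynomials of degree at most $n$; identify $a_0+a_1x+\cdots+a_nx^n$ with $(a_0,\dots,a_n)\in{\bf Z}^{n+1}\subset{\bf R}^{n+1}$ (so $1,x,\dots,x^n$ is an orthonormal basis). The analogous Craig lattice is the ${\bf Z}$-submodule ${\bf A}_n^{(m,l)}={\bf Z}(x-1)^n+{\bf Z}(x-1)^{n-1}+\cdots+{\bf Z}(x-1)^m+l{\bf Z}(x-1)^{m-1}+l{\bf Z}(x-1)^{m-2}+\cdots+l{\bf Z}(x-1)$, viewed as a lattice in ${\bf R}^{n+1}$. The Craig lattice ${\bf A}_n^{(m)}$ is the ideal generated by $(x-1)^m$ in ${\bf Z}[x]/(x^{n+1}-1)$, viewed in ${\bf Z}^{n+1}$ via coefficient vectors of representatives of degree at most $n$. For a lattice ${\bf L}$ with basis ${\bf b}_1,\dots,{\bf b}_r$, its volume is $\det(\langle{\bf b}_i,{\bf b}_j\rangle)^{1/2}$, and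 its minimum norm $\mu({\bf L})$ is the squared Euclidean length of a shortest nonzero vector. *)

(* Defs.v *)
From HB Require Import structures.
From mathcomp Require Import all_boot all_order all_algebra.
From mathcomp Require Import qpoly.
From mathcomp Require Import boolp classical_sets reals.

Set Implicit Arguments.
Unset Strict Implicit.
Unset Printing Implicit Defensive.

Import Order.TTheory GRing.Theory Num.Theory.

Local Open Scope classical_set_scope.
Local Open Scope ring_scope.

Section Lattices.
Variables (R : realType) (N : nat).

(* The rows b_1, ..., b_r of B are the basis vectors. *)
Definition lattice_basis (L : set 'rV[R]_N) (r : nat) (B : 'M[R]_(r, N)) :=
  row_free B /\ L = [set map_mx intr c *m B | c in [set: 'rV[int]_r]].

Definition lattice_of_rank (r : nat) (L : set 'rV[R]_N) :=
  exists B : 'M[R]_(r, N), lattice_basis L B.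

(* B *m B^T is the Gram matrix of the basis; the value does not depend on the
   chosen basis, and the default 0 is only used when L is not a lattice. *)
Definition volume (L : set 'rV[R]_N) : R :=
  xget 0 [set v | exists r (B : 'M[R]_(r, N)),
                    lattice_basis L B /\ v = Num.sqrt (\det (B *m B^T))].

(* The library norm on row vectors is the sup norm, hence this explicit
   Euclidean one. *)
Definition sqnorm (v : 'rV[R]_N) : R := \sum_i v 0 i ^+ 2.

Definition shortest (L : set 'rV[R]_N) (v : 'rV[R]_N) :=
  [/\ L v, v != 0 & forall w, L w -> w != 0 -> sqnorm v <= sqnorm w].

(* All shortest vectors have the same length; the default 0 is only used when
   there is no shortest nonzero vector. *)
Definition min_norm (L : set 'rV[R]_N) : R :=
  xget 0 [set sqnorm v | v in shortest L].

End Lattices.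

(* Identifies polynomials of degree at most n with Z^(n+1) inside R^(n+1). *)
Definition coef_vec (R : realType) (n : nat) (p : {poly int}) : 'rV[R]_n.+1 :=
  map_mx intr (poly_rV p : 'rV[int]_n.+1).
Arguments coef_vec : clear implicits.

Definition analogous_craig_poly (n m l : nat) : set {poly int} :=
  [set p | exists c : nat -> int,
     p = \sum_(m <= k < n.+1) c k *: ('X - 1) ^+ k
       + \sum_(1 <= k < m) c k *: (l%:R *: ('X - 1) ^+ k)].

Definition analogous_craig (R : realType) (n m l : nat) : set 'rV[R]_n.+1 :=
  coef_vec R n @` analogous_craig_poly n m l.
Arguments analogous_craig : clear implicits.

Definition craig_modulus (n : nat) : {poly int} := 'X^(n.+1) - 1.

(* {poly %/ h} is Z[x]/(h) only for h monic and nonconstant. *)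
Lemma mk_monic_craig n : mk_monic (craig_modulus n) = craig_modulus n.
Proof.
by rewrite /mk_monic /craig_modulus size_XnsubC //= -polyC1 monicXnsubC.
Qed.

Definition craig_ideal (n m : nat) : set {poly %/ craig_modulus n} :=
  [set g * in_qpoly (craig_modulus n) (('X - 1) ^+ m) | g in setT].
Arguments craig_ideal : clear implicits.

(* Elements of {poly %/ h} are the representatives of degree < deg h. *)
Definition craig (R : realType) (n m : nat) : set 'rV[R]_n.+1 :=
  [set coef_vec R n (q : {poly int}) | q in craig_ideal n m].
Arguments craig : clear implicits.

(* Main.v *)
(* Write y = X - 1 and h = X^(n+1) - 1. The lattice A_n^(m,l) consists of the
   polynomials of degree at most n in the ideal (y^m, l y) of Z[X]. When
   P = n+1 is prime, h = y^P + P y (1 + y v), and 1 + y v is invertible modulo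
   y^m, so (y^m, h) = (y^m, P y).

   Volume: the row of 1 + X + ... + X^n is orthogonal to the rows of y, ..., y^n
   and has norm n+1; adding it to them gives a matrix of determinant n+1, since
   its constant coefficient in the basis of powers of y is n+1.

   Minimum norm: let f be a nonzero lattice vector with positive and negative
   parts e and d, so that sum e = sum d since f(1) = 0. If the norm is less than
   2m, then sum e < m. Modulo the prime l, (X - 1)^m divides f, hence
   sum_i f_i i^k = 0 for k < m. The polynomials prod_i (1 - i X)^(e_i) and
   prod_i (1 - i X)^(d_i) then solve the same linear equation
   p' + A p = 0 mod X^(m-1), with p(0) = 1, so they agree modulo X^m and, by
   degree, are equal over F_l. As e and d have disjoint supports, f can only be
   supported at index 0, and f(1) = 0 forces f = 0. *)

Require Import Defs.
From mathcomp Require Import all_boot all_order all_algebra.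
From mathcomp Require Import classical_sets reals.
From mathcomp Require Import qpoly boolp ring zify.

Set Implicit Arguments.
Unset Strict Implicit.
Unset Printing Implicit Defensive.

Import Order.TTheory GRing.Theory Num.Theory.
Local Open Scope ring_scope.

(** * Expansion in powers of X - 1 *)

Lemma Taylor_at1 (R : idomainType) n (p : {poly R}) : (size p <= n)%N ->
  p = \sum_(k < n) (p \Po ('X + 1))`_k *: ('X - 1) ^+ k.
Proof.
move=> sp; rewrite -{1}[p](comp_polyXaddC_K p 1) polyC1.
set q := p \Po _.
have sq : (size q <= n)%N by rewrite size_comp_poly2 // -polyC1 size_XaddC.
have {1}-> : q = \sum_(k < n) q`_k *: 'X^k.
  by rewrite -poly_def; apply/polyP => k; rewrite coef_poly; case: ltnP => // nk;
    rewrite nth_default // (leq_trans sq).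
rewrite linear_sum /=; apply: eq_bigr => k _.
by rewrite linearZ /= rmorphXn /= comp_polyX.
Qed.

Lemma comp_subX1 (R : comNzRingType) : ('X - 1 : {poly R}) \Po ('X + 1) = 'X.
Proof. by rewrite comp_polyB comp_polyX -polyC1 comp_polyC addrK. Qed.

Lemma size_subX1_exp (R : idomainType) k : size (('X - 1 : {poly R}) ^+ k) = k.+1.
Proof. by rewrite -polyC1 size_exp_XsubC. Qed.

Lemma monic_subX1_exp (R : nzRingType) k : ('X - 1 : {poly R}) ^+ k \is monic.
Proof. by rewrite -polyC1 monic_exp // monicXsubC. Qed.

Lemma size_sum_le (R : nzRingType) (I : Type) (r : seq I) (P : pred I)
    (F : I -> {poly R}) d :
  (forall i, P i -> (size (F i) <= d)%N) -> (size (\sum_(i <- r | P i) F i)%R <= d)%N.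
Proof.
move=> sF; apply: (big_ind (fun u : {poly R} => (size u <= d)%N)) => // [|u v su sv].
  by rewrite size_poly0.
by rewrite (leq_trans (size_polyD _ _)) // geq_max su.
Qed.

(** * Both lattices as ideals of Z[X] cut at degree n *)

(** In the expansion in powers of y = X - 1, membership in (y^m, l y) constrains only the
    coefficients below y^m: the constant one is zero and the others are multiples of l. *)
Lemma analogous_craig_polyP n m l (p : {poly int}) : (0 < m <= n)%N ->
  analogous_craig_poly n m l p <->
  (size p <= n.+1)%N /\
    exists a b, p = ('X - 1) ^+ m * a + l%:R *: (('X - 1) * b).
Proof.
move=> /andP[m_gt0 lemn]; split=> [[c ->]|[sp [a [b def_p]]]].
  split.
    rewrite (leq_trans (size_polyD _ _)) // geq_max; apply/andP; split.
      rewrite big_nat; apply: size_sum_le => k /andP[_ ltk].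
      by rewrite (leq_trans (size_scale_leq _ _)) // size_subX1_exp.
    rewrite big_nat; apply: size_sum_le => k /andP[_ ltk].
    by rewrite !(leq_trans (size_scale_leq _ _)) // size_subX1_exp; lia.
  exists (\sum_(m <= k < n.+1) c k *: ('X - 1) ^+ (k - m)).
  exists (\sum_(1 <= k < m) c k *: ('X - 1) ^+ k.-1).
  rewrite !mulr_sumr scaler_sumr; congr (_ + _); apply: eq_big_nat => k /andP[lek ltk].
    by rewrite -scalerAr -exprD subnKC.
  by rewrite scalerA [c k * _]mulrC -scalerA -scalerAr -exprS prednK.
set b1 := b \Po ('X + 1); set q := p \Po ('X + 1).
have def_q : q = 'X^m * (a \Po ('X + 1)) + l%:R *: ('X * b1).
  rewrite /q {1}def_p comp_polyD comp_polyZ !comp_polyM comp_subX1.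
  by rewrite rmorphXn /= comp_subX1.
(* Substituting X + 1 for X turns y into X, so [q] lists the coefficients of p in powers of y. Below
   m they are l times those of X [b1], whence the shift by one. *)
exists (fun k => if (k < m)%N then b1`_k.-1 else q`_k).
rewrite {1}(Taylor_at1 sp) -/q -(big_mkord xpredT (fun k => q`_k *: ('X - 1) ^+ k)).
rewrite (big_cat_nat (n := m)) //=; last by rewrite ltnW.
have q_lt k : (k < m)%N -> q`_k = l%:R * ('X * b1)`_k.
  by move=> ltk; rewrite def_q coefD coefXnM ltk add0r coefZ.
rewrite addrC; congr (_ + _).
  by apply: eq_big_nat => k /andP[lek _]; rewrite ltnNge lek.
rewrite big_ltn // q_lt // coefXM mulr0 scale0r add0r.
apply: eq_big_nat => k /andP[lek ltk].
by rewrite ltk q_lt // coefXM eqn0Ngt lek /= [in RHS]scalerA mulrC.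
Qed.

Lemma size_craig_modulus n : size (craig_modulus n) = n.+2.
Proof. by rewrite size_XnsubC. Qed.

Lemma monic_craig_modulus n : craig_modulus n \is monic.
Proof. by rewrite /craig_modulus -polyC1 monicXnsubC. Qed.

(** Pulls the ideal back to Z[X]: reduction modulo the monic h = X^(n+1) - 1 changes a multiple of
    y^m by a multiple of h, and fixes polynomials of degree at most n. *)
Lemma craig_idealP n m (p : {poly int}) :
  (exists2 q, craig_ideal n m q & p = q) <->
  (size p <= n.+1)%N /\ exists a b, p = ('X - 1) ^+ m * a + craig_modulus n * b.
Proof.
have mon := monic_craig_modulus n.
split=> [[_ [g _ <-] ->]|[sp [a [b def_p]]]].
  split.
    rewrite -ltnS (leq_trans (size_mk_monic _)) //.
    by rewrite mk_monic_craig size_craig_modulus.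
  rewrite poly_of_qpolyM /=; move: (polyn g) => {}g.
  rewrite mk_monic_craig Pdiv.RingMonic.rmodp_mulmr //.
  have := Pdiv.RingMonic.rdivp_eq mon (g * ('X - 1) ^+ m).
  set r := Pdiv.CommonRing.rmodp _ _; set d := Pdiv.CommonRing.rdivp _ _ => e.
  by exists g, (- d); rewrite mulrN mulrC e; ring.
exists (in_qpoly (craig_modulus n) a * in_qpoly (craig_modulus n) (('X - 1) ^+ m)).
  by exists (in_qpoly (craig_modulus n) a).
rewrite -in_qpolyM mulrC.
have -> : in_qpoly (craig_modulus n) (('X - 1) ^+ m * a) = in_qpoly (craig_modulus n) p.
  rewrite def_p in_qpolyD [in X in _ = _ + X]in_qpolyM.
  suff -> : in_qpoly (craig_modulus n) (craig_modulus n) = 0 by rewrite mul0r addr0.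
  by apply: val_inj; rewrite /= mk_monic_craig Pdiv.RingMonic.rmodpp.
by rewrite in_qpoly_small // mk_monic_craig size_craig_modulus.
Qed.

(** * Equality with the Craig lattice *)

(** Binomial expansion of (y + 1)^(n+1): a prime n+1 divides every inner binomial coefficient. *)
Lemma craig_modulus_prime n : prime n.+1 -> exists v,
  craig_modulus n = ('X - 1) ^+ n.+1 + n.+1%:R *: (('X - 1) * (1 + ('X - 1) * v)).
Proof.
move=> pr.
exists (\sum_(2 <= k < n.+1) ('C(n.+1, k) %/ n.+1)%N%:R *: ('X - 1) ^+ (k - 2)).
have n_gt0 : (0 < n)%N by have := prime_gt1 pr.
rewrite /craig_modulus -{1}[X in X ^+ _](subrK 1) exprD1n.
rewrite -(big_mkord xpredT (fun k => ('X - 1) ^+ k *+ 'C(n.+1, k))) big_ltn //.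
rewrite bin0 expr0 mulr1n [X in X - 1]addrC addrK big_nat_recr //= binn mulr1n addrC.
congr (_ + _); rewrite big_ltn // bin1 expr1 mulrDr mulr1 scalerDr.
rewrite -[in LHS]scaler_nat; congr (_ + _).
rewrite mulrA !mulr_sumr scaler_sumr; apply: eq_big_nat => k /andP[lek ltk].
have dv : (n.+1 %| 'C(n.+1, k))%N by rewrite prime_dvd_bin // ltk ltnW.
rewrite -{1}(divnK dv) -scalerAr -expr2 -exprD subnKC // scalerA -natrM mulnC.
by rewrite scaler_nat.
Qed.

Lemma analogous_craig_poly_craig n m : (0 < m <= n)%N ->
  prime n.+1 \/ m = 1%N -> forall p,
  analogous_craig_poly n m n.+1 p <-> exists2 q, craig_ideal n m q & p = q.
Proof.
move=> lemn H p; rewrite analogous_craig_polyP // craig_idealP.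
have [/andP[m_gt0 {}lemn]] := (lemn, lemn); set y := 'X - 1 => _.
have h1 : exists d, craig_modulus n = y * d.
  by rewrite /craig_modulus subrX1; eexists.
(* Each ideal contains the remaining generator of the other; [s], [t], [u], [v] are the
   cofactors. *)
have [s [t [u [v [def1 def2]]]]] : exists s t u v,
    n.+1%:R *: y = y ^+ m * s + craig_modulus n * t /\
    craig_modulus n = y ^+ m * u + n.+1%:R *: (y * v).
  case: H => [pr|->]; last first.
    have [d ->] := h1.
    exists n.+1%:R, 0, d, 0; rewrite expr1 !mulr0 scaler0 !addr0; split => //.
    by rewrite mulr_natr scaler_nat.
  have [v def_h] := craig_modulus_prime pr; rewrite -/y in def_h.
  (* Truncated geometric series: the inverse of 1 + y v modulo y^m. *)
  pose w := \sum_(i < m) (- (y * v)) ^+ i.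
  have uw : (1 + y * v) * w = 1 - y ^+ m * (- v) ^+ m.
    have -> : (1 + y * v) * w = - ((- (y * v) - 1) * w) by ring.
    by rewrite -subrX1 -mulrN exprMn opprB.
  have yP : y ^+ n.+1 = y ^+ m * y ^+ (n.+1 - m) by rewrite -exprD subnKC // ltnW.
  exists (n.+1%:R * y * (- v) ^+ m - y ^+ (n.+1 - m) * w), w.
  exists (y ^+ (n.+1 - m)), (1 + y * v).
  split; last by rewrite -yP.
  rewrite def_h -!mul_polyC !polyCMn polyC1.
  have -> : (y ^+ n.+1 + n.+1%:R * (y * (1 + y * v))) * w
     = y ^+ n.+1 * w + n.+1%:R * y * ((1 + y * v) * w) by ring.
  rewrite uw yP; ring.
split=> -[sp [a [b def_p]]]; split=> //.
  exists (a + s * b), (t * b).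
  by rewrite def_p scalerAl def1; ring.
exists (a + u * b), (v * b).
by rewrite def_p def2 mulrDl -scalerAl; rewrite -!mul_polyC; ring.
Qed.

(** * Gram determinants and the volume *)

Lemma lattice_basis_trans (R : realType) N (L : set 'rV[R]_N) r r'
    (B : 'M_(r, N)) (B' : 'M_(r', N)) :
  lattice_basis L B -> lattice_basis L B' ->
  exists U : 'M[int]_(r', r), B' = map_mx intr U *m B.
Proof.
move=> [_ defL] [_ defL'].
have /fin_all_exists[c cP] (i : 'I_r') :
    exists c : 'rV[int]_r, row i B' = map_mx intr c *m B.
  have : L (row i B').
    by rewrite defL'; exists (delta_mx 0 i); rewrite // map_delta_mx -rowE.
  by rewrite defL => -[c _ <-]; exists c.
exists (\matrix_i c i); apply/row_matrixP => i.
by rewrite cP row_mul -map_row rowK.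
Qed.

(** Two bases have equal rank and differ by an integer matrix with integer inverse, whose
    determinant squares to 1; so the set given to [xget] is a singleton. *)
Lemma volume_basis (R : realType) N (L : set 'rV[R]_N) r (B : 'M_(r, N)) :
  lattice_basis L B -> volume L = Num.sqrt (\det (B *m B^T)).
Proof.
move=> LB; apply: xget_unique => [|_ [r' [B' [LB' ->]]]]; first by exists r, B.
have rankE r1 r2 (B1 : 'M_(r1, N)) (B2 : 'M_(r2, N)) :
    lattice_basis L B1 -> lattice_basis L B2 -> (r2 <= r1)%N.
  move=> LB1 LB2; have [U def2] := lattice_basis_trans LB1 LB2.
  have : (\rank B2 <= \rank B1)%N by rewrite def2 mxrankM_maxr.
  by rewrite (eqP LB1.1) (eqP LB2.1).
have er : r' = r.
  by apply/anti_leq; rewrite (rankE _ _ _ _ LB LB') (rankE _ _ _ _ LB' LB).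
subst r'.
have [U defU] := lattice_basis_trans LB LB'.
have [V defV] := lattice_basis_trans LB' LB.
have VU : V *m U = 1%:M.
  have : map_mx intr (V *m U) = 1%:M :> 'M[R]_r.
    rewrite map_mxM; apply: (row_free_inj LB.1).
    by rewrite mul1mx -mulmxA -defU -defV.
  move=> VU1; apply/matrixP => i j; have /matrixP/(_ i j) := VU1.
  rewrite mxE [in RHS]mxE -[RHS](rmorph_nat (intmul 1 : int -> R)).
  by move/intr_inj => ->; rewrite mxE.
have detU : \det U * \det U = 1.
  have : \det U \is a GRing.unit.
    by have [_] := mulmx1_unit VU.
  by case/orP => /eqP ->.
congr Num.sqrt; rewrite defU trmx_mul mulmxA -(mulmxA _ B) !det_mulmx det_tr.
by rewrite det_map_mx mulrAC -rmorphM detU mul1r.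
Qed.

Definition subX1_mx n : 'M[int]_(n, n.+1) :=
  \matrix_i poly_rV (('X - 1) ^+ i.+1).

Lemma det_subX1_mx_gram n : \det (subX1_mx n *m (subX1_mx n)^T) = n.+1%:R.
Proof.
set T := subX1_mx n.
pose q : {poly int} := \poly_(i < n.+1) 1.
have q1 : q.[1] = n.+1%:R.
  rewrite horner_poly (eq_bigr (fun=> 1)) ?sumr_const ?card_ord //.
  by move=> i _; rewrite expr1n mulr1.
have oneT : const_mx 1 *m T^T = 0 :> 'M_(1, n).
  apply/matrixP => i j; rewrite !mxE.
  transitivity ((('X - 1 : {poly int}) ^+ j.+1).[1]).
    rewrite (@horner_coef_wide _ n.+1) ?size_subX1_exp ?ltnS //.
    by apply: eq_bigr => k _; rewrite !mxE mul1r expr1n mulr1.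
  by rewrite horner_exp !hornerE subrr expr0n.
have Tone : T *m (const_mx 1)^T = 0 :> 'M_(n, 1).
  by apply: trmx_inj; rewrite trmx_mul trmxK oneT trmx0.
pose C := col_mx (const_mx 1 : 'rV_n.+1) T : 'M_(1 + n, n.+1).
(* The all-ones row is orthogonal to the rows of [T], so the Gram matrix of [C] is block
   diagonal. *)
have detCC : \det (C *m C^T) = n.+1%:R * \det (T *m T^T).
  rewrite tr_col_mx mul_col_row oneT Tone det_ublock; congr (_ * _).
  rewrite det_mx11 !mxE (eq_bigr (fun=> 1)) ?sumr_const ?card_ord //.
  by move=> i _; rewrite !mxE mulr1.
pose V := col_mx (poly_rV 1) T : 'M_(1 + n, n.+1).
have VE i j : V i j = (('X - 1 : {poly int}) ^+ i)`_j.
  by rewrite mxE; case: splitP => k ->; rewrite !mxE // ord1.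
(* The rows 1, y, ..., y^n form a triangular matrix with unit diagonal. *)
have detV : \det V = 1.
  rewrite det_trig; last first.
    by apply/is_trig_mxP => i j ltij; rewrite VE nth_default // size_subX1_exp.
  apply: big1 => i _; rewrite VE.
  have /monicP := monic_subX1_exp int i.
  by rewrite lead_coefE size_subX1_exp.
have defC : exists e, C = block_mx n.+1%:R%:M e 0 1%:M *m V.
  (* Coefficients of 1 + X + ... + X^n at y, ..., y^n; the one at y^0 is its value n+1 at 1. *)
  exists (\row_j (q \Po ('X + 1))`_j.+1).
  rewrite mul_block_col mul0mx mul1mx add0r; congr col_mx.
  rewrite mul_scalar_mx mulmx_sum_row.
  have -> : const_mx 1 = poly_rV q :> 'rV_n.+1.
    by apply/rowP => j; rewrite !mxE coef_poly ltn_ord.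
  rewrite {1}(Taylor_at1 (size_poly _ _ : (size q <= n.+1)%N)) linear_sum.
  rewrite big_ord_recl /=.
  congr (_ + _).
    by rewrite linearZ expr0 -horner_coef0 horner_comp !hornerE q1.
  by apply: eq_bigr => i _; rewrite linearZ rowK mxE.
have [e {}defC] := defC.
have : \det (C *m C^T) = n.+1%:R * n.+1%:R.
  by rewrite det_mulmx det_tr defC det_mulmx detV det_ublock det1 det_scalar1 !mulr1.
by rewrite detCC => /mulfI -> //; rewrite pnatr_eq0.
Qed.

(** Row i carries y^(i+1), so exactly the first m-1 rows are scaled by l when m is at most n+1. *)
Definition analogous_craig_mx n m l : 'M[int]_(n, n.+1) :=
  diag_mx (\row_i if (i.+1 < m)%N then l%:R else 1) *m subX1_mx n.

Lemma det_analogous_craig_mx_gram n m l : (m <= n)%N ->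
  \det (analogous_craig_mx n m l *m (analogous_craig_mx n m l)^T)
    = (l%:R ^+ m.-1) ^+ 2 * n.+1%:R.
Proof.
move=> lemn.
rewrite /analogous_craig_mx trmx_mul mulmxA -(mulmxA _ (subX1_mx n)).
rewrite !det_mulmx det_tr det_subX1_mx_gram det_diag mulrAC -expr2.
congr (_ ^+ 2 * _); under eq_bigr do rewrite mxE.
rewrite -(big_mkord xpredT (fun i => if (i.+1 < m)%N then l%:R else 1)).
rewrite (big_cat_nat (n := m.-1)) //=; last by lia.
rewrite [X in _ * X]big_nat [X in _ * X]big1; last first.
  by move=> i /andP[lei _]; rewrite ifF //; lia.
rewrite mulr1 big_nat (eq_bigr (fun=> l%:R)); last first.
  by move=> i /andP[_ lti]; rewrite ifT //; lia.
by rewrite -big_nat prodr_const_nat subn0.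
Qed.

Lemma analogous_craig_basis (R : realType) n m l :
  (0 < m <= n)%N -> (0 < l)%N ->
  lattice_basis (analogous_craig R n m l) (map_mx intr (analogous_craig_mx n m l)).
Proof.
move=> /andP[m_gt0 lemn] l_gt0; pose w i : int := if (i.+1 < m)%N then l%:R else 1.
split.
  rewrite /row_free eqn_leq rank_leq_row /=.
  (* A nonzero Gram determinant forces full row rank. *)
  set B := map_mx _ _; have uBB : B *m B^T \in unitmx.
    rewrite unitmxE unitfE map_trmx -map_mxM det_map_mx intr_eq0.
    rewrite det_analogous_craig_mx_gram //.
    by rewrite mulf_neq0 ?expf_neq0 ?pnatr_eq0 // -lt0n.
  by have := mxrankM_maxl B B^T; rewrite mxrank_unit.
have polyE (c : nat -> int) :
    map_mx intr (\row_(i < n) c i.+1) *m map_mx intr (analogous_craig_mx n m l)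
    = coef_vec R n (\sum_(m <= k < n.+1) c k *: ('X - 1) ^+ k
       + \sum_(1 <= k < m) c k *: (l%:R *: ('X - 1) ^+ k)).
  rewrite -map_mxM /coef_vec; congr map_mx.
  have -> : \sum_(m <= k < n.+1) c k *: ('X - 1) ^+ k
       + \sum_(1 <= k < m) c k *: (l%:R *: ('X - 1) ^+ k)
       = \sum_(i < n) c i.+1 *: (w i *: ('X - 1) ^+ i.+1).
    rewrite -(big_mkord xpredT (fun i => c i.+1 *: (w i *: ('X - 1) ^+ i.+1))).
    rewrite -(big_add1 _ _ 0 n.+1 xpredT (fun k => c k *: (w k.-1 *: ('X - 1) ^+ k))).
    rewrite [RHS](big_cat_nat (n := m)) //=; last by rewrite ltnW.
    rewrite [LHS]addrC; congr (_ + _); apply: eq_big_nat => k /andP[lek ltk].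
      by rewrite /w prednK // ltk.
    by rewrite /w prednK ?(leq_trans m_gt0) // ltnNge lek scale1r.
  rewrite linear_sum mulmxA mulmx_sum_row; apply: eq_bigr => i _.
  by rewrite mul_mx_diag !mxE rowK !linearZ /= scalerA.
apply/seteqP; split=> [_ [_ [c ->] <-]|_ [c _ <-]].
  by rewrite -polyE; exists (\row_i c i.+1).
(* Turns the row [c] into a function with indices shifted by one; the default 0 is never reached for
   k from 1 to n. *)
pose d k := if insub k.-1 is Some i then c 0 i else 0.
exists (\sum_(m <= k < n.+1) d k *: ('X - 1) ^+ k
   + \sum_(1 <= k < m) d k *: (l%:R *: ('X - 1) ^+ k)); first by exists d.
rewrite -(polyE d).
by congr (map_mx _ _ *m _); apply/rowP => i; rewrite mxE /d valK.
Qed.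

(** * Power sums determine products of linear factors *)

(** The logarithmic derivative of the product is minus the sum of e_i a_i / (1 - a_i X); here each
    geometric series is cut at X^K. Such equations add up under products, so one factor suffices. *)
Lemma log_deriv_prod (F : comNzRingType) (I : finType) (a : I -> F)
    (e : I -> nat) K : exists r,
  let p := \prod_i (1 - a i *: 'X) ^+ e i in
  p^`() + (\sum_i (\poly_(k < K) a i ^+ k.+1) *+ e i) * p = 'X^K * r.
Proof.
pose S (A p : {poly F}) := exists r, p^`() + A * p = 'X^K * r.
have S1 : S 0 1 by exists 0; rewrite mul0r mulr0 addr0 -polyC1 derivC.
have SM A p B q : S A p -> S B q -> S (A + B) (p * q).
  move=> [r rP] [s sP]; exists (r * q + p * s).
  rewrite derivM mulrDr !mulrA -rP ['X^K * p]mulrC -[p * _ * s]mulrA -sP; ring.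
apply: (big_ind2 S) => // i _; elim: (e i) => [|d IHd]; first by rewrite mulr0n.
rewrite mulrS exprS; apply: SM IHd.
(* The telescoped series times 1 - a X is a - a^(K+1) X^K, and a cancels the derivative -a. *)
exists (- (a i ^+ K.+1)%:P).
have -> : \poly_(k < K) a i ^+ k.+1 = a i *: \sum_(k < K) (a i *: 'X) ^+ k.
  rewrite poly_def scaler_sumr; apply: eq_bigr => k _.
  by rewrite exprZn scalerA exprS.
have := subrX1 (a i *: 'X) K; set G := \sum_(k < K) _ => defG.
have -> : (a i *: G) * (1 - a i *: 'X) = - (a i *: ((a i *: 'X - 1) * G)).
  by rewrite -!mul_polyC; ring.
rewrite -defG exprZn derivB -polyC1 derivC derivZ derivX.
by rewrite -!mul_polyC exprS polyCM; ring.
Qed.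

(** For j < K, the coefficient of X^j in the equation expresses (j+1) D_(j+1) through D_0, ..., D_j,
    and j+1 is nonzero in F. *)
Lemma ode_eq0 (F : idomainType) K (D A r : {poly F}) :
  (forall j, (0 < j <= K)%N -> j%:R != 0 :> F) ->
  D`_0 = 0 -> D^`() + A * D = 'X^K * r -> forall j, (j <= K)%N -> D`_j = 0.
Proof.
move=> charF D0 ode; elim/ltn_ind => -[//|j] IHj ltjK.
have /(congr1 (fun p : {poly F} => p`_j)) := ode.
rewrite coefD coefXnM ltjK coef_deriv coefM big1 => [|i _].
  by move/eqP; rewrite addr0 -mulr_natr mulf_eq0 (negbTE (charF _ _)) ?orbF // => /eqP.
by rewrite IHj ?mulr0 //; lia.
Qed.

(** Modulo X^K the equation involves only the power sums of exponents 1 to K, so the difference of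
    the products solves it with zero constant term. Its degree is at most K, so it vanishes. *)
Lemma power_sums_prod (F : idomainType) (I : finType) (a : I -> F)
    (e f : I -> nat) K :
  (forall j, (0 < j <= K)%N -> j%:R != 0 :> F) ->
  (forall k, (0 < k <= K)%N -> \sum_i a i ^+ k *+ e i = \sum_i a i ^+ k *+ f i) ->
  (\sum_i e i <= K)%N -> (\sum_i f i <= K)%N ->
  \prod_i (1 - a i *: 'X) ^+ e i = \prod_i (1 - a i *: 'X) ^+ f i.
Proof.
move=> charF eq_sums leeK lefK.
have sizeP (d : I -> nat) : (\sum_i d i <= K)%N ->
    (size (\prod_i (1 - a i *: 'X) ^+ d i)%R <= K.+1)%N.
  move=> ledK; apply: (@leq_trans (\sum_i d i).+1); last by [].
  pose K' (p : {poly F}) s := (size p <= s.+1)%N.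
  apply: (big_ind2 K') => [|p s q t|i _]; rewrite /K'.
  - by rewrite size_poly1.
  - by move=> sp sq; rewrite (leq_trans (size_polyMleq _ _)) //; lia.
  - elim: (d i) => [|k IHk]; first by rewrite size_poly1.
    rewrite exprS (leq_trans (size_polyMleq _ _)) //.
    have : (size (1 - a i *: 'X)%R <= 2)%N.
      rewrite (leq_trans (size_polyD _ _)) // geq_max size_poly1 size_polyN.
      by rewrite (leq_trans (size_scale_leq _ _)) // size_polyX.
    by move=> s2; rewrite -subn1 leq_subLR; exact: leq_add s2 IHk.
have coef0P (d : I -> nat) : (\prod_i (1 - a i *: 'X) ^+ d i)`_0 = 1.
  rewrite -horner_coef0 horner_prod big1 // => i _.
  by rewrite horner_exp !hornerE ?mulr0 ?subr0 expr1n.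
have [r /= odee] := log_deriv_prod a e K.
have [s /= odef] := log_deriv_prod a f K.
set A := \sum_i (\poly_(k < K) a i ^+ k.+1) *+ e i in odee.
have eqA : A = \sum_i (\poly_(k < K) a i ^+ k.+1) *+ f i.
  apply/polyP => k; rewrite /A !coef_sum.
  have [ltkK|leKk] := ltnP k K.
    have := eq_sums k.+1; rewrite /= ltkK => /(_ isT).
    by congr (_ = _); apply: eq_bigr => i _; rewrite coefMn coef_poly ltkK.
  by rewrite !big1 // => i _; rewrite coefMn coef_poly ltnNge leKk mul0rn.
rewrite -eqA in odef.
apply/eqP; rewrite -subr_eq0; set D := _ - _; apply/eqP/polyP => j; rewrite coef0.
have [lejK|ltKj] := leqP j K; last first.
  rewrite nth_default // (leq_trans (size_polyD _ _)) // geq_max size_polyN.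
  by rewrite !(leq_trans (sizeP _ _)).
apply: (ode_eq0 charF _ _ lejK (A := A) (r := r - s)).
  by rewrite coefB !coef0P subrr.
by rewrite /D derivB mulrBr mulrBr -odee -odef; ring.
Qed.

Lemma power_sums_disjoint (F : fieldType) (I : finType) (a : I -> F)
    (e f : I -> nat) K : injective a ->
  (forall j, (0 < j <= K)%N -> j%:R != 0 :> F) ->
  (forall k, (0 < k <= K)%N -> \sum_i a i ^+ k *+ e i = \sum_i a i ^+ k *+ f i) ->
  (\sum_i e i <= K)%N -> (\sum_i f i <= K)%N ->
  (forall i, e i = 0%N \/ f i = 0%N) -> forall i, a i != 0 -> e i = 0%N.
Proof.
move=> inj_a charF eq_sums leeK lefK disj i ai0.
have [//|/eqP ei0] := eqVneq (e i) 0%N.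
have fi0 : f i = 0%N by case: (disj i).
have := power_sums_prod charF eq_sums leeK lefK.
(* If e_i > 0, the left product vanishes at 1/a_i; so does a factor on the right, which by
   injectivity has index i, against f_i = 0. *)
move/(congr1 (fun p : {poly F} => p.[(a i)^-1])).
rewrite !horner_prod (bigD1 i) //= horner_exp !hornerE mulfV // subrr.
rewrite expr0n (introF eqP ei0) mul0r => /esym/eqP/prodf_eq0[j _].
rewrite horner_exp !hornerE expf_eq0 => /andP[fj0].
rewrite subr_eq0 => /eqP/(congr1 (fun x => x * a i)).
rewrite mul1r mulfVK // => /inj_a eij; by rewrite -eij fi0 in fj0.
Qed.

(* The Euler operator [X d/dX] multiplies the i-th coefficient by i and lowers
   the order of vanishing at 1 by at most one. *)
Lemma power_sum_coef (F : comNzRingType) N k (p g : {poly F}) :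
  (size p <= N)%N -> p = ('X - 1) ^+ k.+1 * g ->
  \sum_(i < N) p`_i * i%:R ^+ k = 0.
Proof.
elim: k p g => [|k IHk] p g sp def_p.
  rewrite (_ : \sum_(i < N) _ = p.[1]); last first.
    by rewrite (horner_coef_wide _ sp); apply: eq_bigr => i _; rewrite expr1n expr0.
  by rewrite def_p !hornerE subrr mul0r.
rewrite -[RHS](IHk ('X * p^`()) ('X * (g *+ k.+2 + ('X - 1) * g^`()))).
- apply: eq_bigr => i _; rewrite coefXM coef_deriv; case: (i : nat) => [|j] /=.
    by rewrite expr0n mulr0 mul0r.
  by rewrite exprS mulrA mulr_natr.
- apply/leq_sizeP => -[|j] leNj; rewrite coefXM //= coef_deriv.
  by rewrite nth_default ?mul0rn // (leq_trans sp).
rewrite def_p derivM deriv_exp derivB -polyC1 derivC derivX subr0 mul1r /=.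
rewrite -(mulr_natr g) -(mulr_natr (_ ^+ k.+1)) [_ ^+ k.+2]exprS.
by move: (_ ^+ k.+1) (k.+2%:R) => y c; ring.
Qed.

(** * The minimum norm *)

Lemma sqnorm_intr (R : realType) N (u : 'rV[int]_N) :
  sqnorm (map_mx intr u : 'rV[R]_N) = (\sum_i `|u ord0 i| ^ 2)%N%:R.
Proof.
rewrite natr_sum; apply: eq_bigr => i _.
by rewrite mxE natrX natr_absz intr_norm real_normK ?num_real.
Qed.

(** Squared lengths of integer vectors are natural numbers, so a shortest nonzero vector exists and
    [min_norm] does not take its default value. *)
Lemma min_norm_ge (R : realType) N (L : set 'rV[R]_N) (c : R) :
  (forall v, L v -> exists u : 'rV[int]_N, v = map_mx intr u) ->
  (exists2 v, L v & v != 0) ->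
  (forall v, L v -> v != 0 -> c <= sqnorm v) -> c <= min_norm L.
Proof.
move=> intL [v0 Lv0 v0_neq0] geL.
suff : exists v, shortest L v.
  move=> [v vP]; rewrite /min_norm; set S := (X in xget 0 X).
  have [x [Lx x0 _] <-] : S (xget 0 S); last exact: geL.
  by apply: xgetPex; exists (sqnorm v), v.
pose P k := `[< exists2 u : 'rV[int]_N,
   L (map_mx intr u) /\ map_mx intr u != 0 :> 'rV[R]_N
   & k = (\sum_i `|u ord0 i| ^ 2)%N >].
have exP : exists k, P k.
  have [u def_v] := intL _ Lv0; exists (\sum_i `|u ord0 i| ^ 2)%N.
  by apply/asboolP; exists u; rewrite -?def_v.
have [k /asboolP[x [Lx x0] def_k] min_k] := ex_minnP exP.
exists (map_mx intr x); split=> // y Ly y0.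
have [z def_y] := intL _ Ly; rewrite def_y !sqnorm_intr ler_nat -def_k; apply: min_k.
by apply/asboolP; exists z; rewrite -?def_y.
Qed.

Lemma analogous_craig_norm_ge n m l (p : {poly int}) :
  (0 < m <= n)%N -> prime l -> (n < l)%N ->
  analogous_craig_poly n m l p -> p != 0 ->
  (2 * m <= \sum_(i < n.+1) `|(p`_i)%R| ^ 2)%N.
Proof.
move=> lemn l_pr ltnl /(analogous_craig_polyP _ _ lemn)[sp [a [b def_p]]].
have /andP[m_gt0 {}lemn] := lemn.
have p1 : \sum_(i < n.+1) p`_i = 0.
  transitivity p.[1].
    by rewrite (horner_coef_wide _ sp); apply: eq_bigr => i _; rewrite expr1n mulr1.
  have y1 : ('X - 1 : {poly int}).[1] = 0 by rewrite -polyC1 hornerXsubC subrr.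
  rewrite def_p hornerD hornerZ !hornerM horner_exp y1 expr0n eqn0Ngt m_gt0.
  by rewrite !mul0r mulr0 addr0.
apply: contraNT; rewrite -ltnNge => small.
(* Positive and negative parts; [Negz k] stands for -(k+1). *)
pose e (i : 'I_n.+1) : nat := if p`_i is Posz k then k else 0.
pose f (i : 'I_n.+1) : nat := if p`_i is Negz k then k.+1 else 0.
have pE (i : 'I_n.+1) : p`_i = (e i)%:Z - (f i)%:Z.
  by rewrite /e /f; case: p`_i => k; rewrite ?subr0 ?sub0r // NegzE.
have ef_le (i : 'I_n.+1) : (e i + f i <= `|(p`_i)%R| ^ 2)%N.
  by rewrite /e /f; case: p`_i => k; rewrite ?addn0 ?add0n /=; nia.
have disj i : e i = 0%N \/ f i = 0%N by rewrite /e /f; case: p`_i; [right|left].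
have eq_ef : (\sum_i e i = \sum_i f i)%N.
  have /eqP := p1; rewrite (eq_bigr _ (fun i _ => pE i)) sumrB subr_eq0.
  by rewrite -!(big_morph Posz PoszD (erefl _)) => /eqP[].
(* As |t| is at most t^2 on integers, the two equal sums add up to less than 2m. *)
have lte : (\sum_i e i <= m.-1)%N.
  have := leq_ltn_trans (leq_sum _ (fun i _ => ef_le i)) small.
  by rewrite big_split /= -eq_ef; move: (\sum_i e i)%N => N; lia.
have ltf : (\sum_i f i <= m.-1)%N by rewrite -eq_ef.
have chl := pchar_Fp l_pr.
have natF_neq0 j : (0 < j < l)%N -> j%:R != 0 :> 'F_l.
  by move=> /andP[j0 jl]; rewrite -(dvdn_pcharf chl) gtnNdvd.
have charF j : (0 < j <= m.-1)%N -> j%:R != 0 :> 'F_l.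
  by move=> ?; apply: natF_neq0; lia.
(* Since n < l, the indices 0, ..., n stay distinct modulo l. *)
pose x (i : 'I_n.+1) : 'F_l := i%:R.
have lt_x (i j : 'I_n.+1) : (i < j)%N -> x i <> x j.
  move=> ltij eqij; have : (j - i)%N%:R != 0 :> 'F_l.
    by apply: natF_neq0; have := ltn_ord j; lia.
  by rewrite natrB 1?ltnW // -/(x i) -/(x j) eqij subrr eqxx.
have inj_x : injective x.
  move=> i j eqij; have [/lt_x/(_ eqij)[]|/lt_x/(_ (esym eqij))[]|/ord_inj] := ltngtP i j.
  by [].
have sums k : (0 < k <= m.-1)%N -> \sum_i x i ^+ k *+ e i = \sum_i x i ^+ k *+ f i.
  move=> lekm; apply/eqP; rewrite -subr_eq0 -sumrB; apply/eqP.
  pose pF : {poly 'F_l} := map_poly (intmul 1) p.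
  (* Modulo l only the multiple of (X - 1)^m survives; this is its cofactor after splitting off (X -
     1)^(k+1). *)
  pose g : {poly 'F_l} := ('X - 1) ^+ (m - k.+1) * map_poly (intmul 1) a.
  rewrite -[RHS](@power_sum_coef _ n.+1 k pF g).
  - apply: eq_bigr => i _; rewrite coef_map /= pE rmorphB /= mulrBl.
    by rewrite !mulr_natl.
  - exact: leq_trans (size_poly _ _) sp.
  rewrite /pF /g def_p rmorphD rmorphM rmorphXn rmorphB /=.
  rewrite map_polyX rmorph1 map_polyZ /=.
  rewrite (_ : intmul 1 _ = 0); last by rewrite rmorph_nat pchar_Fp_0.
  by rewrite scale0r addr0 mulrA -exprD subnKC //; lia.
have e0 := power_sums_disjoint inj_x charF sums lte ltf disj.
have f0 := power_sums_disjoint inj_x charF (fun k lek => esym (sums k lek)) ltf lte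
  (fun i => proj1 (or_comm _ _) (disj i)).
have pS (i : 'I_n.+1) : i != ord0 -> p`_i = 0.
  rewrite -val_eqE /= -lt0n => i0; have xi0 : x i != 0.
    by apply: natF_neq0; have := ltn_ord i; lia.
  by rewrite pE e0 // f0.
apply/eqP/polyP => i; rewrite coef0.
have [ltin|leni] := ltnP i n.+1; last by rewrite nth_default // (leq_trans sp).
have [->|i0] := eqVneq i 0%N; last exact: (pS (Ordinal ltin)).
(* The other coefficients vanish, so the constant one equals p(1) = 0. *)
by rewrite -[RHS]p1 (bigD1 ord0) //= big1 ?addr0.
Qed.

Lemma coef_vecE (R : realType) n (p : {poly int}) i : coef_vec R n p 0 i = (p`_i)%:~R.
Proof. by rewrite !mxE. Qed.

Lemma sqnorm_coef_vec (R : realType) n (p : {poly int}) :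
  sqnorm (coef_vec R n p) = (\sum_(i < n.+1) `|(p`_i)%R| ^ 2)%N%:R.
Proof.
rewrite /coef_vec sqnorm_intr.
by under eq_bigr do rewrite mxE.
Qed.

Theorem theorem2p1 (R : realType) (n m l : nat)
    (n_gt0 : (0 < n)%N) (m_gt0 : (0 < m)%N) (l_gt0 : (0 < l)%N)
    (ltmn : m%:R < n%:R / 2 :> R) (lenl : (n.+1 <= l)%N) :
  (prime n.+1 \/ m = 1%N ->
     analogous_craig R n m n.+1 = craig R n m) /\
  (lattice_of_rank n (analogous_craig R n m l) /\
   volume (analogous_craig R n m l)
     = l%:R ^+ (m - 1)%N * Num.sqrt (n%:R + 1) /\
   (prime l -> 2 * m%:R <= min_norm (analogous_craig R n m l))).
Proof.
have lemn : (m <= n)%N.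
  by move: ltmn; rewrite ltr_pdivlMr // -natrM ltr_nat; lia.
have lemn' : (0 < m <= n)%N by rewrite m_gt0.
split=> [H|].
  have eq_craig := analogous_craig_poly_craig lemn' H.
  apply/seteqP; split=> [_ [p /eq_craig[q Jq ->] <-]|_ [q Jq <-]]; first by exists q.
  by exists (q : {poly int}) => //; apply/eq_craig; exists q.
have LB := analogous_craig_basis R lemn' l_gt0.
split; first by eexists; exact: LB.
split=> [|l_pr].
  rewrite (volume_basis LB) map_trmx -map_mxM det_map_mx det_analogous_craig_mx_gram //.
  rewrite rmorphM !rmorphXn /= !rmorph_nat sqrtrM ?sqr_ge0 // sqrtr_sqr.
  by rewrite ger0_norm ?exprn_ge0 // -subn1 -natr1.
apply: min_norm_ge => [_ [p _ <-]||_ [p Sp <-] p0].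
- by exists (poly_rV p).
(* The vector of y^n shows that the lattice is nonzero: its last coordinate is 1. *)
- have y_neq0 : coef_vec R n (('X - 1) ^+ n) != 0.
    apply/eqP => /rowP/(_ ord_max); rewrite coef_vecE mxE /=.
    have /monicP := monic_subX1_exp int n.
    by rewrite lead_coefE size_subX1_exp /= => ->; apply/eqP; rewrite oner_neq0.
  exists (coef_vec R n (('X - 1) ^+ n)) => //; exists (('X - 1) ^+ n) => //.
  apply/(analogous_craig_polyP _ _ lemn'); rewrite size_subX1_exp; split=> //.
  by exists (('X - 1) ^+ (n - m)), 0; rewrite mulr0 scaler0 addr0 -exprD subnKC.
rewrite sqnorm_coef_vec -natrM ler_nat.
apply: (analogous_craig_norm_ge lemn' l_pr lenl Sp).
by apply: contra_neq p0 => ->; rewrite /coef_vec linear0 map_mx0.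
Qed.
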